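(* Fix $p\in(0,1)$. For each integer $G\ge1$ let $k\sim\mathrm{Binomial}(G,p)$ and $g=\frac{\sqrt{k(G-k)}}{G}$. Then, as $G\to\infty$, $$\mathbb{E}[g]=\sqrt{p(1-p)}\left(1-\frac{1}{8\,G\,p(1-p)}+O(G^{-2})\right).$$
   Context: Here $g=\sqrt{k(G-k)}/G$ is the per-prompt GRPO update for a one-dimensional Bernoulli-logit prompt with success probability $p$ when $k$ of the $G$ sampled responses are correct. The constant in $O(G^{-2})$ may depend on the fixed value $p$. *)

(* Defs.v *)
From HB Require Import structures.
From mathcomp Require Export all_boot all_order all_algebra.
From mathcomp Require Export all_classical all_reals all_analysis.

Set Implicit Arguments.
Unset Strict Implicit.
Unset Printing Implicit Defensive.

Import Order.TTheory GRing.Theory Num.Theory.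
Import numFieldNormedType.Exports.

Local Open Scope ring_scope.

(* The subtraction is that of [R]; only [k <= G] is charged by a binomial law,
   and [Num.sqrt] is 0 on the negative reals. *)
Definition grpo_update (R : realType) (G k : nat) : R :=
  Num.sqrt (k%:R * (G%:R - k%:R)) / G%:R.

(* Main.v *)
(* With [s = p (1 - p)], [c = 1 - 2 p], [x = k / G] and [d = x - p] one has
   [x (1 - x) = s (1 + u)] where [u = (c d - d ^ 2) / s].  For [u >= -1] the
   third-order Taylor polynomial of [sqrt (1 + u)] is off by at most
   [5/16 u ^ 4], a global bound, so no concentration inequality is needed:
   [sqrt (1 + u)] is a cubic polynomial in [d] up to a multiple of [d ^ 4].
   The central moments of the binomial law then give the expansion, [E d ^ 3]
   and [E d ^ 4] being both [O(G ^ -2)]. *)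
Require Import Defs.
From mathcomp Require Import all_boot all_order all_algebra.
From mathcomp Require Import all_classical all_reals all_analysis.
From mathcomp Require Import ring lra.

Set Implicit Arguments.
Unset Strict Implicit.
Unset Printing Implicit Defensive.

Import Order.TTheory GRing.Theory Num.Theory.
Import numFieldNormedType.Exports.

Local Open Scope classical_set_scope.
Local Open Scope ring_scope.

(** * Taylor expansion of the square root *)

(** With [t = sqrt (1 + u)] the error is exactly [- (t - 1)^4 (t^2 + 4 t + 5) / 16], while
    [u^4 = (t - 1)^4 (t + 1)^4]. It remains to see [t^2 + 4 t + 5 <= 5 (t + 1)^4] for [t >= 0],
    which holds coefficientwise. Equality occurs at [u = -1]. *)
Lemma sqrt1D_taylor3 (R : rcfType) (u : R) : -1 <= u ->
  `|Num.sqrt (1 + u) - (1 + u / 2 - u ^+ 2 / 8 + u ^+ 3 / 16)|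
    <= 5 / 16 * u ^+ 4.
Proof.
move=> u_ge; have := sqrtr_ge0 (1 + u).
have : Num.sqrt (1 + u) ^+ 2 = 1 + u by rewrite sqr_sqrtr// -lerBlDl sub0r.
move: (Num.sqrt _) => t tE t0.
have {u u_ge tE} -> : u = t ^+ 2 - 1 by rewrite tE addrAC subrr add0r.
rewrite (_ : t - _ = - ((t - 1) ^+ 4 * ((t ^+ 2 + 4 * t + 5) / 16))); last by field.
have d0 : 0 <= (t - 1) ^+ 4 by rewrite exprn_even_ge0.
have t2 : 0 <= t ^+ 2 by rewrite exprn_ge0.
have t3 : 0 <= t ^+ 3 by rewrite exprn_ge0.
have t4 : 0 <= t ^+ 4 by rewrite exprn_ge0.
rewrite normrN ger0_norm; last by apply: mulr_ge0 => //; lra.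
rewrite (_ : 5 / 16 * _ = (t - 1) ^+ 4 * (5 / 16 * (t + 1) ^+ 4)); last by ring.
apply: ler_wpM2l => //.
rewrite (_ : (t + 1) ^+ 4 = t ^+ 4 + 4 * t ^+ 3 + 6 * t ^+ 2 + 4 * t + 1); last by ring.
by lra.
Qed.

Lemma sqrt_variance_expansion (R : rcfType) (p x : R) :
    0 < p < 1 -> 0 <= x <= 1 ->
  let s := p * (1 - p) in let c := 1 - 2 * p in let d := x - p in
  `|Num.sqrt (x * (1 - x)) / Num.sqrt s
     - (1 + c / (2 * s) * d - ((2 * s)^-1 + c ^+ 2 / (8 * s ^+ 2)) * d ^+ 2
        + (c / (4 * s ^+ 2) + c ^+ 3 / (16 * s ^+ 3)) * d ^+ 3)|
    <= ((8 * s ^+ 2)^-1 + 7 / (16 * s ^+ 3) + 5 / s ^+ 4) * d ^+ 4.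
Proof.
move=> /andP[p0 p1] /andP[x0 x1]; cbv zeta.
set s := p * (1 - p); set c := 1 - 2 * p; set d := x - p.
have s0 : 0 < s by rewrite /s; nra.
have sn0 : s != 0 by rewrite gt_eqF.
have d1 : `|d| <= 1 by rewrite ler_norml /d; lra.
have c1 : `|c| <= 1 by rewrite ler_norml /c; lra.
pose u := (c * d - d ^+ 2) / s.
have uE : x * (1 - x) = s * (1 + u).
  by rewrite [RHS]mulrDr mulr1 [s * u]mulrC divfK// /s /c /d; ring.
have u_ge : -1 <= u.
  have : 0 <= s * (1 + u) by rewrite -uE; nra.
  by rewrite pmulr_rge0//; lra.
have -> : Num.sqrt (x * (1 - x)) / Num.sqrt s = Num.sqrt (1 + u).
  by rewrite uE sqrtrM ?ltW// mulrAC divff ?mul1r// gt_eqF// sqrtr_gt0.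
have d4 : 0 <= d ^+ 4 by rewrite exprn_even_ge0.
set P := (X in `|_ - X|).
set T := 1 + u / 2 - u ^+ 2 / 8 + u ^+ 3 / 16.
(* [P] is [T] expanded in [d] and cut after degree 3; the terms of degrees 4, 5 and 6 remain. *)
have TP : T - P =
    (- (8 * s ^+ 2)^-1 + (-3 * c ^+ 2 + 3 * c * d - d ^+ 2) / (16 * s ^+ 3))
    * d ^+ 4.
  by rewrite /T /P /u; field.
(* Here [7 = 3 + 3 + 1], from [|c| <= 1] and [|d| <= 1]. *)
have TP_le : `|T - P| <= ((8 * s ^+ 2)^-1 + 7 / (16 * s ^+ 3)) * d ^+ 4.
  rewrite TP normrM (ger0_norm d4); apply: ler_wpM2r => //.
  apply: le_trans (ler_normD _ _) _; rewrite normrN.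
  have i2 : 0 <= (8 * s ^+ 2)^-1 by rewrite invr_ge0 mulr_ge0// exprn_ge0// ltW.
  have i3 : 0 <= (16 * s ^+ 3)^-1 by rewrite invr_ge0 mulr_ge0// exprn_ge0// ltW.
  rewrite (ger0_norm i2) lerD2l normrM (ger0_norm i3).
  apply: ler_wpM2r => //.
  move: d1 c1; rewrite !ler_norml => /andP[? ?] /andP[? ?].
  by apply/andP; split; nra.
(* Since [u = (c - d) d / s] and [|c - d| <= 2], the constant is [2^4]. *)
have u4 : u ^+ 4 <= 16 / s ^+ 4 * d ^+ 4.
  rewrite /u (_ : c * d - d ^+ 2 = (c - d) * d); last by ring.
  rewrite expr_div_n exprMn mulrAC; apply: ler_wpM2r => //.
  apply: ler_wpM2r; first by rewrite invr_ge0 exprn_ge0// ltW.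
  have : (c - d) ^+ 2 <= 4.
    by move: d1 c1; rewrite !ler_norml => /andP[? ?] /andP[? ?]; nra.
  have : 0 <= (c - d) ^+ 2 by rewrite sqr_ge0.
  by rewrite (_ : (c - d) ^+ 4 = ((c - d) ^+ 2) ^+ 2); [nra|ring].
rewrite (_ : _ - P = (Num.sqrt (1 + u) - T) + (T - P)); last by ring.
apply: le_trans (ler_normD _ _) _.
have := sqrt1D_taylor3 u_ge; rewrite -/T => sT.
rewrite mulrDl addrC; apply: lerD => //; apply: le_trans sT _.
rewrite (_ : 5 / s ^+ 4 * d ^+ 4 = 5 / 16 * (16 / s ^+ 4 * d ^+ 4)); last by field.
by apply: ler_wpM2l => //; lra.
Qed.

Lemma error_coef_gt0 (R : realFieldType) (s : R) : 0 < s ->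
  0 < (8 * s ^+ 2)^-1 + 7 / (16 * s ^+ 3) + 5 / s ^+ 4.
Proof.
move=> s0; have sj j : 0 < s ^+ j by rewrite exprn_gt0.
apply: addr_gt0; last by apply: divr_gt0.
apply: addr_gt0; first by rewrite invr_gt0; apply: mulr_gt0.
by apply: divr_gt0 => //; apply: mulr_gt0.
Qed.

(** * Binomial means and central moments *)

(** A finite sum, so that moments follow by induction on [n] without measure theory;
    [expectation_binomial] links it to ['E_P]. *)
Definition binomial_mean (R : realType) (n : nat) (p : R) (f : nat -> R) : R :=
  \sum_(k < n.+1) binomial_pmf n p k * f k.

Section binomial_mean.
Context (R : realType) (p : R).
Implicit Types (f g : nat -> R) (n k : nat).

Lemma eq_binomial_mean n f g : (forall k, (k <= n)%N -> f k = g k) ->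
  binomial_mean n p f = binomial_mean n p g.
Proof. by move=> fg; apply: eq_bigr => k _; rewrite fg// -ltnS. Qed.

Lemma binomial_meanD n f g :
  binomial_mean n p (fun k => f k + g k) =
  binomial_mean n p f + binomial_mean n p g.
Proof. by rewrite -big_split/=; apply: eq_bigr => k _; rewrite mulrDr. Qed.

Lemma binomial_meanZ n a f :
  binomial_mean n p (fun k => a * f k) = a * binomial_mean n p f.
Proof. by rewrite mulr_sumr; apply: eq_bigr => k _; rewrite mulrCA. Qed.

Lemma le_binomial_mean n f g : 0 <= p <= 1 ->
  (forall k, (k <= n)%N -> f k <= g k) ->
  binomial_mean n p f <= binomial_mean n p g.
Proof.
move=> p01 fg; apply: ler_sum => k _.
by rewrite ler_wpM2l ?binomial_pmf_ge0// fg// -ltnS.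
Qed.

Lemma binomial_pmf_small n k : (n < k)%N -> binomial_pmf n p k = 0.
Proof. by move=> nk; rewrite /binomial_pmf bin_small. Qed.

Lemma binomial_pmfSS n k : (k <= n)%N ->
  binomial_pmf n.+1 p k.+1 =
  p * binomial_pmf n p k + (1 - p) * binomial_pmf n p k.+1.
Proof.
(* The case [k = n] is apart: rewriting [n - k] as a successor needs [k < n]. *)
rewrite leq_eqVlt => /predU1P[->|kn].
  by rewrite (@binomial_pmf_small n n.+1)// /binomial_pmf !binn !subnn exprS; ring.
rewrite /binomial_pmf binS subSS -(subnSK kn) /unstable.onem !exprS mulrnDr.
by move: 'C(n, k) 'C(n, k.+1) => a b; ring.
Qed.

(** Conditioning on one trial: a success, of probability [p], shifts the count by one. *)
Lemma binomial_meanS n f :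
  binomial_mean n.+1 p f =
  p * binomial_mean n p (f \o succn) + (1 - p) * binomial_mean n p f.
Proof.
rewrite {1}/binomial_mean big_ord_recl/=.
under eq_bigr => k _.
  rewrite [X in X * _]binomial_pmfSS; last by rewrite -ltnS.
  rewrite mulrDl -!mulrA; over.
rewrite big_split/= -!mulr_sumr addrCA; congr (_ + _).
(* A null term at [k = n + 1] is added, so that splitting off [k = 0] leaves the shifted sum. *)
have -> : binomial_mean n p f = \sum_(k < n.+2) binomial_pmf n p k * f k.
  by rewrite [RHS]big_ord_recr/= binomial_pmf_small// mul0r addr0.
rewrite [in RHS]big_ord_recl mulrDr; congr (_ + _).
by rewrite /binomial_pmf /unstable.onem/= !subn0 !bin0 !expr0 exprS; ring.
Qed.

Definition binomial_cmoment n (j : nat) : R :=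
  binomial_mean n p (fun k => (k%:R - n%:R * p) ^+ j).

Lemma binomial_cmoment0 n : binomial_cmoment n 0 = 1.
Proof.
elim: n => [|n IH].
  by rewrite /binomial_cmoment /binomial_mean big_ord1 /binomial_pmf bin0 !expr0 !mulr1.
transitivity (p * binomial_cmoment n 0 + (1 - p) * binomial_cmoment n 0).
  exact: binomial_meanS.
by rewrite IH !mulr1 subrKC.
Qed.

(** One more trial moves the centred count by [1 - p] or by [- p]. Expanding the powers gives each
    moment at [n + 1] from those of order at most [j] at [n]. *)
Lemma binomial_cmomentS n j :
  binomial_cmoment n.+1 j =
  binomial_mean n p (fun k => p * (k%:R - n%:R * p + (1 - p)) ^+ j
                              + (1 - p) * (k%:R - n%:R * p - p) ^+ j).
Proof.
rewrite /binomial_cmoment binomial_meanS binomial_meanD !binomial_meanZ.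
congr (_ * _ + _ * _); apply: eq_binomial_mean => k _ /=; congr (_ ^+ _).
  by rewrite -(natr1 k) -(natr1 n); ring.
by rewrite -(natr1 n); ring.
Qed.

Lemma binomial_cmoment_at0 j : binomial_cmoment 0 j.+1 = 0.
Proof.
by rewrite /binomial_cmoment /binomial_mean big_ord1 mul0r subrr expr0n mulr0.
Qed.

Lemma binomial_cmoment1 n : binomial_cmoment n 1 = 0.
Proof.
elim: n => [|n IH]; first exact: binomial_cmoment_at0.
rewrite binomial_cmomentS -[RHS]IH; apply: eq_binomial_mean => k _.
by ring.
Qed.

Lemma binomial_cmoment2 n : binomial_cmoment n 2 = n%:R * (p * (1 - p)).
Proof.
elim: n => [|n IH]; first by rewrite binomial_cmoment_at0 mul0r.
rewrite binomial_cmomentS -natr1 mulrDl -IH mul1r.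
(* Writing the constant as a multiple of the zeroth moment turns the goal into an equality of means,
   settled by a pointwise polynomial identity. *)
have -> : p * (1 - p) = p * (1 - p) * binomial_cmoment n 0.
  by rewrite binomial_cmoment0 mulr1.
rewrite -binomial_meanZ -binomial_meanD; apply: eq_binomial_mean => k _.
by ring.
Qed.

Lemma binomial_cmoment3 n :
  binomial_cmoment n 3 = n%:R * (p * (1 - p) * (1 - 2 * p)).
Proof.
elim: n => [|n IH]; first by rewrite binomial_cmoment_at0 mul0r.
rewrite binomial_cmomentS -natr1 mulrDl -IH mul1r.
set s := p * (1 - p).
(* The first moment is zero, but its term is needed for the identity to hold pointwise. *)
have -> : s * (1 - 2 * p) = 3 * s * binomial_cmoment n 1
    + s * (1 - 2 * p) * binomial_cmoment n 0.
  by rewrite binomial_cmoment0 binomial_cmoment1; ring.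
rewrite -!binomial_meanZ -!binomial_meanD; apply: eq_binomial_mean => k _.
by rewrite /s; ring.
Qed.

Lemma binomial_cmoment4 n :
  binomial_cmoment n 4 = 3 * (p * (1 - p)) ^+ 2 * n%:R ^+ 2
    + n%:R * (p * (1 - p) * (1 - 6 * (p * (1 - p)))).
Proof.
elim: n => [|n IH]; first by rewrite binomial_cmoment_at0; ring.
rewrite binomial_cmomentS; set s := p * (1 - p) in IH *.
transitivity (binomial_cmoment n 4 + (6 * s * binomial_cmoment n 2
    + (4 * s * (1 - 2 * p) * binomial_cmoment n 1
       + s * (1 - 3 * s) * binomial_cmoment n 0))).
  rewrite -!binomial_meanZ -!binomial_meanD; apply: eq_binomial_mean => k _.
  by rewrite /s; ring.
rewrite IH binomial_cmoment0 binomial_cmoment1 binomial_cmoment2 -/s.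
by rewrite -(natr1 n); ring.
Qed.

Lemma le_norm_binomial_mean n f : 0 <= p <= 1 ->
  `|binomial_mean n p f| <= binomial_mean n p (fun k => `|f k|).
Proof.
move=> p01; apply: le_trans (ler_norm_sum _ _ _) _; apply: ler_sum => k _.
by rewrite normrM ger0_norm// binomial_pmf_ge0.
Qed.

End binomial_mean.

(** * Expansion of the mean update *)

Lemma grpo_updateE (R : realType) (G k : nat) : (0 < G)%N ->
  grpo_update R G k = Num.sqrt (k%:R / G%:R * (1 - k%:R / G%:R)).
Proof.
move=> G0; have Gn0 : G%:R != 0 :> R by rewrite pnatr_eq0 -lt0n.
rewrite (_ : _ * _ = (G%:R^-1) ^+ 2 * (k%:R * (G%:R - k%:R))); last by field.
by rewrite sqrtrM ?sqr_ge0// sqrtr_sqr ger0_norm ?invr_ge0 ?ler0n// mulrC.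
Qed.

(** In the constant, the first summand is the exact contribution of [E d^3 = s c / G^2]; the second
    is the pointwise error coefficient times the 4 of [E d^4 <= 4 / G^2]. *)
Lemma binomial_mean_grpo_update (R : realType) (p : R) (G : nat) :
    0 < p < 1 -> (0 < G)%N ->
  let s := p * (1 - p) in let c := 1 - 2 * p in
  `|binomial_mean G p (grpo_update R G) / Num.sqrt s
     - (1 - (8 * G%:R * p * (1 - p))^-1)|
    <= (`|(c / (4 * s ^+ 2) + c ^+ 3 / (16 * s ^+ 3)) * s * c|
        + ((8 * s ^+ 2)^-1 + 7 / (16 * s ^+ 3) + 5 / s ^+ 4) * 4)
       * G%:R ^- 2.
Proof.
move=> p01 G0; have /andP[p0 p1] := p01; cbv zeta.
set s := p * (1 - p); set c := 1 - 2 * p.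
have p01' : 0 <= p <= 1 by rewrite !ltW.
have s0 : 0 < s by rewrite /s; nra.
have s1 : s <= 1 by rewrite /s; nra.
have sn0 : s != 0 by rewrite gt_eqF.
have G0' : 0 < G%:R :> R by rewrite ltr0n.
have G1 : 1 <= G%:R :> R by rewrite ler1n.
have Gn0 : G%:R != 0 :> R by rewrite gt_eqF.
set b := c / (4 * s ^+ 2) + c ^+ 3 / (16 * s ^+ 3).
set K := (8 * s ^+ 2)^-1 + _ + _.
have K0 : 0 <= K.
  exact/ltW/error_coef_gt0.
pose d k : R := (k%:R - G%:R * p) / G%:R.
pose a := (2 * s)^-1 + c ^+ 2 / (8 * s ^+ 2).
pose Q k : R := 1 + c / (2 * s) * d k - a * d k ^+ 2 + b * d k ^+ 3.
have meand j : binomial_mean G p (fun k => d k ^+ j)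
    = G%:R ^- j * binomial_cmoment p G j.
  rewrite -binomial_meanZ; apply: eq_binomial_mean => k _.
  by rewrite expr_div_n mulrC.
have meanQ : binomial_mean G p Q
    = 1 - (8 * G%:R * p * (1 - p))^-1 + b * s * c * G%:R ^- 2.
  transitivity (binomial_mean G p (fun k => d k ^+ 0)
      + (c / (2 * s) * binomial_mean G p (fun k => d k ^+ 1)
      + (- a * binomial_mean G p (fun k => d k ^+ 2)
         + b * binomial_mean G p (fun k => d k ^+ 3)))).
    rewrite -!binomial_meanZ -!binomial_meanD; apply: eq_binomial_mean => k _.
    by rewrite /Q; ring.
  rewrite !meand binomial_cmoment0 binomial_cmoment1 binomial_cmoment2.
  rewrite binomial_cmoment3 -/s -/c -(mulrA _ p) -/s.
  (* By [4 s + c^2 = 1]; with [E d^2 = s / G] this yields the term [1 / (8 G s)]. *)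
  have aE : a = (8 * s ^+ 2)^-1.
    have -> : a = (4 * s + c ^+ 2) / (8 * s ^+ 2) by rewrite /a; field.
    by rewrite -[RHS]mul1r; congr (_ / _); rewrite /s /c; ring.
  by rewrite aE; field; rewrite Gn0.
(* Here [4 = 3 + 1]: the quadratic part of the fourth moment is at most [3 G^2], the linear part at
   most [G^2]. *)
have mean4 : binomial_mean G p (fun k => d k ^+ 4) <= 4 * G%:R ^- 2.
  rewrite meand binomial_cmoment4 -/s.
  rewrite (_ : 4 * _ = G%:R ^- 4 * (4 * G%:R ^+ 2)); last by field.
  apply: ler_wpM2l; first by rewrite invr_ge0 exprn_ge0// ltW.
  have : G%:R * (s * (1 - 6 * s)) <= G%:R ^+ 2.
    rewrite expr2; apply: ler_wpM2l; first exact: ltW.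
    by nra.
  have : 3 * s ^+ 2 * G%:R ^+ 2 <= 3 * G%:R ^+ 2.
    by apply: ler_wpM2r; rewrite ?sqr_ge0//; nra.
  by lra.
have errQ : `|binomial_mean G p (grpo_update R G) / Num.sqrt s
    - binomial_mean G p Q| <= K * (4 * G%:R ^- 2).
  apply: le_trans (ler_wpM2l K0 mean4).
  rewrite -binomial_meanZ mulrC -mulN1r -!binomial_meanZ -binomial_meanD.
  apply: le_trans (le_norm_binomial_mean _ _ p01') _.
  apply: le_binomial_mean => // k kG.
  have x01 : 0 <= (k%:R / G%:R : R) <= 1.
    by rewrite divr_ge0 ?ler0n//= ler_pdivrMr// mul1r ler_nat.
  have := sqrt_variance_expansion p01 x01; cbv zeta; rewrite -/s -/c -/a -/b -/K.
  have -> : k%:R / G%:R - p = d k by rewrite /d; field.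
  by rewrite grpo_updateE// mulN1r mulrC.
rewrite (_ : _ - _ = binomial_mean G p (grpo_update R G) / Num.sqrt s
    - binomial_mean G p Q + b * s * c * G%:R ^- 2); last first.
  by rewrite meanQ; ring.
apply: le_trans (ler_normD _ _) _.
rewrite [leRHS]mulrDl [leRHS]addrC -[K * 4 * _]mulrA; apply: lerD => //.
by rewrite normrM ler_wpM2l// ger0_norm// invr_ge0 exprn_ge0// ltW.
Qed.

(** * Transfer to random variables *)

(** Change of variables to the law of [k]; nonnegativity of [f] spares any integrability
    argument. *)
Lemma expectation_binomial (R : realType) (p : R) (n : nat) (f : nat -> R)
    (d : measure_display) (T : measurableType d) (P : probability T R)
    (k : {RV P >-> nat}) :
    0 <= p <= 1 -> (forall i, 0 <= f i) ->
    (forall A : set nat, distribution P k A = binomial_prob n p A) ->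
  'E_P[(fun w : T => f (k w))]%E = (binomial_mean n p f)%:E.
Proof.
move=> /andP[p0 p1] f0 Pk; rewrite unlock.
have f0' i : (0 <= (f i)%:E)%E by rewrite lee_fin.
transitivity (\int[distribution P k]_y (f y)%:E)%E.
  by rewrite (@ge0_integral_distribution _ _ _ _ _ _ _ (EFin \o f)).
rewrite (@eq_measure_integral _ _ _ _ (binomial_prob n p)); last first.
  by move=> A _ _; exact: Pk.
by rewrite (@integral_binomial _ n p p0 p1)// -sumEFin.
Qed.

Theorem corollary1 (R : realType) (p : R) (p_gt0 : 0 < p) (p_lt1 : p < 1) :
  exists2 e : nat -> R,
    e =O_\oo (fun G : nat => (G%:R : R) ^- 2)
  & forall (G : nat), (1 <= G)%N ->
    forall (d : measure_display) (T : measurableType d) (P : probability T R)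
           (k : {RV P >-> nat}),
      (forall A : set nat, distribution P k A = binomial_prob G p A) ->
      'E_P[(fun w : T => grpo_update R G (k w))]%E =
        (Num.sqrt (p * (1 - p)) *
           (1 - (8 * G%:R * p * (1 - p))^-1 + e G))%:E.
Proof.
have p01 : 0 < p < 1 by rewrite p_gt0.
set s := p * (1 - p).
have s0 : 0 < s by rewrite /s; nra.
(* The relative error is read off the finite sum, hence is the same for all probability spaces. *)
exists (fun G => binomial_mean G p (grpo_update R G) / Num.sqrt s
                 - (1 - (8 * G%:R * p * (1 - p))^-1)).
  apply/eqO_exP.
  set c := 1 - 2 * p.
  exists (`|(c / (4 * s ^+ 2) + c ^+ 3 / (16 * s ^+ 3)) * s * c|
        + ((8 * s ^+ 2)^-1 + 7 / (16 * s ^+ 3) + 5 / s ^+ 4) * 4).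
    (* The constant must be positive; the first summand vanishes at [p = 1/2], so positivity comes
       from the second. *)
    by apply: ltr_wpDl => //; apply: mulr_gt0 => //; exact: error_coef_gt0.
  exists 1%N => // G /= G1.
  rewrite [X in _ <= _ * X]ger0_norm ?invr_ge0 ?exprn_ge0//.
  exact: binomial_mean_grpo_update.
move=> G G1 d T P k Pk.
rewrite (expectation_binomial (p := p) (n := G)) ?(ltW p_gt0) ?(ltW p_lt1)//.
  by congr EFin; rewrite addrC subrK mulrC divfK// gt_eqF// sqrtr_gt0.
by move=> i; rewrite divr_ge0 ?sqrtr_ge0.
Qed.
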